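(* Let $\pi$ be an abelian group of finite order $p$ and let $n\ge1$. Then the virtual Euler-Poincaré characteristic of the canonical reduced $\Theta_n$-set $K(\pi,n)$ is $\chi(K(\pi,n))=p^{(-1)^n}$.
   Context: $K(\pi,n)$ is the reduced $\Theta_n$-set $\gamma_n^*(H\pi)$. Its realisation $|K(\pi,n)|_{\Theta_n}$ is a CW-complex; let $c_d$ be its number of $d$-cells and $K(\pi,n)(t)=\sum_{d\ge0}c_dt^d$ the generating function, which is the power series expansion of a rational function. The virtual Euler-Poincaré characteristic is by definition the value of this rational function at $t=-1$: $\chi(K(\pi,n))=K(\pi,n)(-1)$. The objects involved are defined as follows. **$\Gamma$ and $H\pi$.** $\Gamma$ is the category with objects $\underline m=\{1,\dots,m\}$, $m\ge 0$; an operator $\underline m\to\underline l$ is an ordered $m$-tuple $(N_1,\dots,N_m)$ of pairwise disjoint subsets of $\underline l$; the composite of $(M_1,\dots,M_k):\underline k\to\underline m$ with $(N_1,\dots,N_m):\underline m\to\underline l$ is $(\bigcup_{j\in M_1}N_j,\dots,\bigcup_{j\in M_k}N_j)$. $H\pi:\Gamma^{op}\to\mathbf{Sets}$ is $H\pi(\underline k)=\pi^k$, with $(N_1,\dots,N_m):\underline m\to\underline l$ acting by $(a_j)_j\mapsto(\sum_{j\in N_i}a_j)_i$. **$\Theta_n$.** $\Delta$ is the category of ordinals $[m]=\{0<\dots<m\}$, $m\ge 0$, and order-preserving maps. For a small category $\mathcal A$, $\Delta\wr\mathcal A$ has as objects the tuples $(A_1,\dots,A_m)$ ($m\ge 0$)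 of objects of $\mathcal A$; a morphism $(A_1,\dots,A_m)\to(B_1,\dots,B_l)$ is a tuple $(\phi;\phi_1,\dots,\phi_m)$ with $\phi:[m]\to[l]$ in $\Delta$ and $\phi_i=(\phi_i^k:A_i\to B_k)_{\phi(i-1)<k\le\phi(i)}$ a family of morphisms of $\mathcal A$; composition is induced by composition in $\Delta$ and $\mathcal A$. $\Theta_0$ is the terminal category, $\Theta_1=\Delta\cong\Delta\wr\Theta_0$, $\Theta_n=\Delta\wr\Theta_{n-1}$. Objects of $\Theta_n$ are identified with finite planar rooted level-trees of height $\le n$: $(T_1,\dots,T_m)$ is the tree whose root has $m$ incoming edges, with $T_i$ grafted on top of the $i$-th; the object of $\Theta_0$ and the empty tuple are the tree consisting of the root only. **Assembly functors** $\gamma_n:\Theta_n\to\Gamma$. $\gamma_0$ has value $\underline 1$. Inductively, $\gamma_n(T_1,\dots,T_m)=\underline{q_1+\dots+q_m}$ where $\gamma_{n-1}(T_i)=\underline{q_i}$, identified with $\bigsqcup_i\gamma_{n-1}(T_i)$ by concatenation; $\gamma_n(\phi;\phi_1,\dots,\phi_m):\gamma_n(S_1,\dots,S_m)\to\gamma_n(T_1,\dots,T_l)$ assigns to $a\in\gamma_{n-1}(S_i)$ the subset $\bigcup_{\phi(i-1)<k\le\phi(i)}\gamma_{n-1}(\phi_i^k)(a)$. **Cells.** For a $\Theta_n$-set $X$, the CW-complex $|X|_{\Theta_n}$ is the geometric realisation of the $n$-simplicial set $\delta_n^*X$ (where $\delta_1=\mathrm{id}_\Delta$, $\delta_n=(\Delta\wr\delta_{n-1})\circ\delta_{\Delta^{\times(n-1)}}:\Delta^{\times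 n}\to\Theta_n$, $\delta_{\mathcal A}([m],A)=(A,\dots,A)$ ($m$ times), $\delta_{\mathcal A}(\phi,f)$ having all components $f$), with the CW-structure having one cell for each non-degenerate element $x\in X(T)$ (one not in the image of $X(\rho)$ for any non-identity retraction $\rho:T\to S$ of $\Theta_n$), of dimension the number of edges of $T$. *)

(* Defs.v *)
From mathcomp Require Import all_boot all_order all_algebra.
From mathcomp Require Import boolp classical_sets functions cardinality.

Set Implicit Arguments.
Unset Strict Implicit.
Unset Printing Implicit Defensive.

Import GRing.Theory.

Record category := Category {
  ob :> Type;
  hom : ob -> ob -> Type;
  idm : forall A, hom A A;
  comp : forall A B C, hom B C -> hom A B -> hom A C;
  comp1m : forall A B (f : hom A B), comp (idm B) f = f;
  compm1 : forall A B (f : hom A B), comp f (idm A) = f;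
  compA : forall A B C D (h : hom C D) (g : hom B C) (f : hom A B),
    comp h (comp g f) = comp (comp h g) f
}.
Arguments hom {c} _ _.
Arguments idm {c} _.
Arguments comp {c A B C} _ _.

Record functor (C D : category) := Functor {
  fob :> C -> D;
  fmap : forall A B, hom A B -> hom (fob A) (fob B);
  fmap1 : forall A, fmap (idm A) = idm (fob A);
  fmapM : forall A B E (g : hom B E) (f : hom A B),
    fmap (comp g f) = comp (fmap g) (fmap f)
}.
Arguments fmap {C D} _ {A B} _.

Record presheaf (C : category) := Presheaf {
  sec :> C -> Type;
  restr : forall A B, hom A B -> sec B -> sec A;
  restr1 : forall A (x : sec A), restr (idm A) x = x;
  restrM : forall A B E (g : hom B E) (f : hom A B) (x : sec E),
    restr (comp g f) x = restr f (restr g x)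
}.
Arguments restr {C} _ {A B} _ _.

Section Pullback.
Variables (C D : category) (F : functor C D) (X : presheaf D).

Definition pullback_restr (A B : C) (f : hom A B) : X (F B) -> X (F A) :=
  restr X (fmap F f).

Fact pullback_restr1 A (x : X (F A)) : pullback_restr (idm A) x = x.
Proof. by rewrite /pullback_restr fmap1 restr1. Qed.

Fact pullback_restrM A B E (g : hom B E) (f : hom A B) (x : X (F E)) :
  pullback_restr (comp g f) x = pullback_restr f (pullback_restr g x).
Proof. by rewrite /pullback_restr fmapM restrM. Qed.

Definition pullback : presheaf C :=
  @Presheaf C (fun A => X (F A)) pullback_restr pullback_restr1 pullback_restrM.
End Pullback.

(* Objects of Gamma are natural numbers m, standing for the set 'I_m. *)
Section Gamma.

Record gamma_hom (m l : nat) := GammaHom {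
  gset :> {ffun 'I_m -> {set 'I_l}};
  gset_disj : forall i j, i != j -> [disjoint gset i & gset j]
}.

Lemma gamma_homP m l (f g : gamma_hom m l) : (forall i, f i = g i) -> f = g.
Proof.
case: f g => f df [g dg] /= fg.
have e : f = g by apply/ffunP.
by case: _ / e in dg fg *; congr GammaHom; apply: Prop_irrelevance.
Qed.

Lemma gset_inj m l (f : gamma_hom m l) i j a : a \in f i -> a \in f j -> i = j.
Proof.
move=> ai aj; apply/eqP; apply: contraT => /(gset_disj f) /pred0P /(_ a) /=.
by rewrite ai aj.
Qed.

Lemma disj_of_inj m l (N : 'I_m -> {set 'I_l}) :
  (forall i j a, a \in N i -> a \in N j -> i = j) ->
  forall i j, i != j -> [disjoint [ffun i => N i] i & [ffun i => N i] j].
Proof.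
move=> N_inj i j ij; rewrite !ffunE; apply/pred0P => a /=.
by apply/negP => /andP[ai aj]; rewrite (N_inj _ _ _ ai aj) eqxx in ij.
Qed.

Fact gamma_id_inj m (i j a : 'I_m) :
  a \in [set i]%SET -> a \in [set j]%SET -> i = j.
Proof. by rewrite !inE => /eqP<- /eqP. Qed.

Definition gamma_id m : gamma_hom m m := GammaHom (disj_of_inj (@gamma_id_inj m)).

Fact gamma_comp_inj k m l (g : gamma_hom m l) (f : gamma_hom k m) i j a :
  a \in (\bigcup_(b in f i) g b)%SET -> a \in (\bigcup_(b in f j) g b)%SET ->
  i = j.
Proof.
move=> /bigcupP[b bi ab] /bigcupP[c cj ac].
by rewrite (gset_inj ab ac) in bi; apply: gset_inj bi cj.
Qed.

Definition gamma_comp k m l (g : gamma_hom m l) (f : gamma_hom k m) :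
  gamma_hom k l := GammaHom (disj_of_inj (@gamma_comp_inj k m l g f)).

Fact gamma_comp1m m l (f : gamma_hom m l) : gamma_comp (gamma_id l) f = f.
Proof.
apply: gamma_homP => i; rewrite !ffunE; apply/setP => a.
apply/bigcupP/idP => [[b bi]|ai]; first by rewrite ffunE inE => /eqP->.
by exists a => //; rewrite ffunE inE.
Qed.

Fact gamma_compm1 m l (f : gamma_hom m l) : gamma_comp f (gamma_id m) = f.
Proof. by apply: gamma_homP => i; rewrite !ffunE big_set1. Qed.

Fact gamma_compA k m l q (h : gamma_hom l q) (g : gamma_hom m l)
  (f : gamma_hom k m) :
  gamma_comp h (gamma_comp g f) = gamma_comp (gamma_comp h g) f.
Proof.
apply: gamma_homP => i; rewrite !ffunE; apply/setP => a.
apply/bigcupP/bigcupP => [[b /bigcupP[c ci bc] ab]|[c ci]].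
  by exists c => //; rewrite ffunE; apply/bigcupP; exists b.
rewrite ffunE => /bigcupP[b bc ab]; exists b => //.
by apply/bigcupP; exists c.
Qed.

Definition Gamma : category :=
  Category gamma_comp1m gamma_compm1 gamma_compA.

End Gamma.

Section EilenbergMacLaneGammaSet.
Variable pi : zmodType.
Local Open Scope ring_scope.

Definition H_restr (m l : Gamma) (N : hom m l) (a : {ffun 'I_l -> pi}) :
  {ffun 'I_m -> pi} := [ffun i => \sum_(j in gset N i) a j].

Fact H_restr1 m a : H_restr (idm m) a = a.
Proof. by apply/ffunP => i; rewrite !ffunE big_set1. Qed.

Fact H_restrM (k m l : Gamma) (g : hom m l) (f : hom k m) a :
  H_restr (comp g f) a = H_restr f (H_restr g a).
Proof.
apply/ffunP => i; rewrite !ffunE.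
under [RHS]eq_bigr do rewrite ffunE.
rewrite (exchange_big_dep (mem (\bigcup_(b in gset f i) gset g b)%SET)) /=; last first.
  by move=> b j bi jb; apply/bigcupP; exists b.
apply: eq_bigr => j /bigcupP[b bi jb].
rewrite (big_pred1 b) // => c /=; apply/andP/eqP => [[_ jc]|->//].
exact: gset_inj jc jb.
Qed.

Definition H : presheaf Gamma :=
  @Presheaf Gamma (fun k : nat => {ffun 'I_k -> pi}) H_restr H_restr1 H_restrM.

End EilenbergMacLaneGammaSet.

(* The object m of Delta stands for the ordinal [m], with m.+1 elements. *)
Section Delta.

Record delta_hom (m l : nat) := DeltaHom {
  dfun :> {ffun 'I_m.+1 -> 'I_l.+1};
  dfun_mono : forall i j : 'I_m.+1, i <= j -> dfun i <= dfun j
}.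

Lemma delta_homP m l (f g : delta_hom m l) : (forall i, f i = g i) -> f = g.
Proof.
case: f g => f df [g dg] /= fg.
have e : f = g by apply/ffunP.
by case: _ / e in dg fg *; congr DeltaHom; apply: Prop_irrelevance.
Qed.

Fact delta_id_mono m (i j : 'I_m.+1) :
  i <= j -> [ffun k : 'I_m.+1 => k] i <= [ffun k : 'I_m.+1 => k] j.
Proof. by rewrite !ffunE. Qed.

Definition delta_id m : delta_hom m m := DeltaHom (@delta_id_mono m).

Fact delta_comp_mono k m l (g : delta_hom m l) (f : delta_hom k m)
  (i j : 'I_k.+1) :
  i <= j -> [ffun a => g (f a)] i <= [ffun a => g (f a)] j.
Proof. by rewrite !ffunE => ij; do 2!apply: dfun_mono. Qed.

Definition delta_comp k m l (g : delta_hom m l) (f : delta_hom k m) :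
  delta_hom k l := DeltaHom (@delta_comp_mono k m l g f).

Fact delta_comp1m m l (f : delta_hom m l) : delta_comp (delta_id l) f = f.
Proof. by apply: delta_homP => i; rewrite !ffunE. Qed.

Fact delta_compm1 m l (f : delta_hom m l) : delta_comp f (delta_id m) = f.
Proof. by apply: delta_homP => i; rewrite !ffunE. Qed.

Fact delta_compA k m l q (h : delta_hom l q) (g : delta_hom m l)
  (f : delta_hom k m) :
  delta_comp h (delta_comp g f) = delta_comp (delta_comp h g) f.
Proof. by apply: delta_homP => i; rewrite !ffunE. Qed.

Definition Delta : category :=
  Category delta_comp1m delta_compm1 delta_compA.

(* Edges are indexed from 0: the edge i : 'I_m goes from the vertex i to the
   vertex i.+1 of [m]. In the usual indexing from 1, the condition below is
   phi (i - 1) < k <= phi i. *)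
Definition in_fiber m l (phi : delta_hom m l) (i : 'I_m) (k : 'I_l) : bool :=
  phi (widen_ord (leqnSn m) i) <= k < phi (lift ord0 i).

Lemma in_fiber_inj m l (phi : delta_hom m l) i j k :
  in_fiber phi i k -> in_fiber phi j k -> i = j.
Proof.
have lt_absurd (a b : 'I_m) : in_fiber phi a k -> in_fiber phi b k -> b <= a.
  move=> /andP[_ ka] /andP[bk _]; rewrite leqNgt; apply/negP => ab.
  have /(dfun_mono phi)/(leq_trans ka)/leq_trans/(_ bk) :
    lift ord0 a <= widen_ord (leqnSn m) b by [].
  by rewrite ltnn.
by move=> hi hj; apply: val_inj; apply/eqP; rewrite eqn_leq !lt_absurd.
Qed.

Lemma in_fiber_id m (i k : 'I_m) : in_fiber (delta_id m) i k -> i = k.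
Proof.
by rewrite /in_fiber !ffunE /= /bump /= add1n ltnS -eqn_leq => /eqP/val_inj.
Qed.

Lemma in_fiber_id_refl m (i : 'I_m) : in_fiber (delta_id m) i i.
Proof. by rewrite /in_fiber !ffunE /= /bump /= add1n leqnn ltnSn. Qed.

Lemma in_fiber_comp k m l (psi : delta_hom m l) (phi : delta_hom k m) i j a :
  in_fiber phi i j -> in_fiber psi j a -> in_fiber (delta_comp psi phi) i a.
Proof.
move=> /andP[ij ji] /andP[ja aj]; rewrite /in_fiber !ffunE; apply/andP; split.
  by apply: leq_trans ja; apply: dfun_mono.
by apply: leq_trans aj _; apply: dfun_mono.
Qed.

Lemma in_fiber_factor k m l (psi : delta_hom m l) (phi : delta_hom k m) i a :
  in_fiber (delta_comp psi phi) i a ->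
  exists j, in_fiber phi i j && in_fiber psi j a.
Proof.
rewrite /in_fiber !ffunE => /andP[].
set u := phi _; set v := phi _ => ua av.
have exP : exists n, (n < m.+1) && (a < psi (inord n)).
  by exists v; rewrite ltn_ord inord_val.
case: (ex_minnP exP) => n /andP[n_lt an] n_min.
have un : u < n.
  rewrite ltnNge; apply/negP => nu.
  have /(dfun_mono psi) : (inord n : 'I_m.+1) <= u by rewrite inordK.
  by move=> /(leq_trans an)/leq_trans/(_ ua); rewrite ltnn.
have nv : n <= v by apply: n_min; rewrite ltn_ord inord_val.
case: n => // n in n_lt an n_min un nv *.
exists (Ordinal (n_lt : n < m)); rewrite [_ <= _]un [_ < _]nv /=.
have -> : lift ord0 (Ordinal (n_lt : n < m)) = inord n.+1.
  by apply: val_inj; rewrite /= inordK.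
rewrite an andbT leqNgt; apply/negP => an'.
suff : n.+1 <= n by rewrite ltnn.
apply: n_min; rewrite (ltnW n_lt) /=.
by have -> : inord n = widen_ord (leqnSn m) (Ordinal (n_lt : n < m));
   last by []; apply: val_inj; rewrite /= inordK // ltnW.
Qed.

End Delta.

Section Wreath.
Variable A : category.
Local Notation "S `_[ i ]" := (tnth (in_tuple S) i) (at level 3).

Record wreath_hom (S T : seq A) := WreathHom {
  base : delta_hom (size S) (size T);
  fib : forall (i : 'I_(size S)) (k : 'I_(size T)),
    in_fiber base i k -> hom S`_[i] T`_[k]
}.

Lemma wreath_homP S T (f g : wreath_hom S T) :
  (forall i, base f i = base g i) ->
  (forall i k (hf : in_fiber (base f) i k) (hg : in_fiber (base g) i k),
     fib hf = fib hg) -> f = g.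
Proof.
case: f g => f F [g G] /= /delta_homP e; case: _ / e in G * => FG.
congr WreathHom.
apply: functional_extensionality_dep => i.
apply: functional_extensionality_dep => k.
by apply: functional_extensionality_dep => h; apply: FG.
Qed.

Definition wreath_id S : wreath_hom S S :=
  @WreathHom S S (delta_id (size S)) (fun i k h =>
    let: erefl in _ = k := in_fiber_id h return hom S`_[i] S`_[k]
    in idm S`_[i]).

(* The component at (i, k) of a composite is the composite of the components
   at (i, j) and (j, k) for the unique intermediate edge j. *)
Definition wreath_comp S T U (g : wreath_hom T U) (f : wreath_hom S T) :
  wreath_hom S U :=
  @WreathHom S U (delta_comp (base g) (base f)) (fun i k h =>
    let e := in_fiber_factor h in
    let hj := andP (xchooseP e) in
    comp (fib (proj2 hj)) (fib (proj1 hj))).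

Lemma fib_irr S T (f : wreath_hom S T) i k (h h' : in_fiber (base f) i k) :
  fib h = fib h'.
Proof. by rewrite (bool_irrelevance h h'). Qed.

Lemma fib_id S i (h : in_fiber (base (wreath_id S)) i i) :
  fib h = idm S`_[i].
Proof. by rewrite /=; rewrite (eq_axiomK (in_fiber_id h)). Qed.

Lemma fib_comp S T U (g : wreath_hom T U) (f : wreath_hom S T) i j k
  (h : in_fiber (base (wreath_comp g f)) i k)
  (hf : in_fiber (base f) i j) (hg : in_fiber (base g) j k) :
  fib h = comp (fib hg) (fib hf).
Proof.
rewrite /=; move: (proj1 _) (proj2 _) => /=.
move: (xchoose _) => j' hf' hg'.
have e := in_fiber_inj hg hg'; case: _ / e in hf' hg' *.
by congr comp; apply: fib_irr.
Qed.

Fact wreath_comp1m S T (f : wreath_hom S T) : wreath_comp (wreath_id T) f = f.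
Proof.
apply: wreath_homP => [i|i k h hf]; first by rewrite !ffunE.
by rewrite (fib_comp h hf (in_fiber_id_refl k)) fib_id comp1m.
Qed.

Fact wreath_compm1 S T (f : wreath_hom S T) : wreath_comp f (wreath_id S) = f.
Proof.
apply: wreath_homP => [i|i k h hf]; first by rewrite !ffunE.
by rewrite (fib_comp h (in_fiber_id_refl i) hf) fib_id compm1.
Qed.

Fact wreath_compA S T U V (h : wreath_hom U V) (g : wreath_hom T U)
  (f : wreath_hom S T) :
  wreath_comp h (wreath_comp g f) = wreath_comp (wreath_comp h g) f.
Proof.
apply: wreath_homP => [i|i k hl hr]; first by rewrite !ffunE.
have [u /andP[hgf hh]] := in_fiber_factor hl.
have [j /andP[hf hg]] := in_fiber_factor hgf.
have hhg : in_fiber (base (wreath_comp h g)) j k by exact: in_fiber_comp hg hh.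
by rewrite (fib_comp hl hgf hh) (fib_comp hgf hf hg) (fib_comp hr hf hhg)
  (fib_comp hhg hg hh) compA.
Qed.

Definition wreath : category :=
  Category wreath_comp1m wreath_compm1 wreath_compA.

Section Assembly.
Variable F : functor A Gamma.

Definition assembly_ob (S : wreath) : Gamma :=
  \sum_(i < size S) (F S`_[i] : nat).

(* tagnat.Rank i : 'I_(p_ i) -> 'I_(\sum_i p_ i) includes the i-th block of the
   concatenation; tagnat.sig1 and tagnat.sig2 are the block of an element and
   its position there. *)
Definition assembly_set S T (f : wreath_hom S T) (a : 'I_(assembly_ob S)) :
  {set 'I_(assembly_ob T)} :=
  (\bigcup_(k : {k | in_fiber (base f) (tagnat.sig1 a) k})
     tagnat.Rank (val k) @: gset (fmap F (fib (valP k))) (tagnat.sig2 a))%SET.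

Lemma Rank_tag_inj n (p_ : 'I_n -> nat) (i : 'I_n) :
  injective (@tagnat.Rank n p_ i).
Proof.
move=> j j' /(congr1 val)/eqP /=; rewrite tagnat.eq_Rank eqxx /=.
by move/eqP/val_inj.
Qed.

Lemma assembly_setP S T (f : wreath_hom S T) i (a : 'I_(F S`_[i]))
    k (b : 'I_(F T`_[k])) :
  reflect (exists h : in_fiber (base f) i k, b \in gset (fmap F (fib h)) a)
    (tagnat.Rank k b \in assembly_set f (tagnat.Rank i a)).
Proof.
have eqs : tagnat.sig (tagnat.Rank i a) =
  existT (fun i => 'I_(F S`_[i])) i a by rewrite tagnat.rankK.
rewrite /assembly_set /tagnat.sig1 /tagnat.sig2 eqs /=.
apply: (iffP bigcupP) => [[[k' h] _ /imsetP[b' b'a]]|[h ba]].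
  move=> /(congr1 val)/eqP /=; rewrite tagnat.eq_Rank => /andP[/eqP e].
  case: _ / e in h b' b'a * => /eqP/val_inj->.
  by exists h; rewrite (fib_irr h (valP (exist _ k h))).
exists (exist _ k h) => //; apply: imset_f.
by rewrite (fib_irr (valP (exist _ k h)) h).
Qed.

Lemma Rank_surj n (p_ : 'I_n -> nat) (s : 'I_(\sum_i p_ i)) :
  exists i a, s = @tagnat.Rank n p_ i a.
Proof. by exists (tagnat.sig1 s), (tagnat.sig2 s); rewrite tagnat.sig2K. Qed.

Fact assembly_inj S T (f : wreath_hom S T) a a' b :
  b \in assembly_set f a -> b \in assembly_set f a' -> a = a'.
Proof.
have [i [{}a ->]] := Rank_surj a; have [i' [{}a' ->]] := Rank_surj a'.
have [k [{}b ->]] := Rank_surj b.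
move=> /assembly_setP[h ba] /assembly_setP[h' ba'].
have e := in_fiber_inj h h'; case: _ / e in a' h' ba' *.
by rewrite (fib_irr h' h) in ba'; rewrite (gset_inj ba ba').
Qed.

Definition assembly_map (S T : wreath) (f : hom S T) :
  hom (assembly_ob S) (assembly_ob T) :=
  GammaHom (disj_of_inj (@assembly_inj S T f)).

Fact assembly_map1 S : assembly_map (idm S) = idm (assembly_ob S).
Proof.
apply: gamma_homP => a; rewrite !ffunE; apply/setP => b.
have [i [{}a ->]] := Rank_surj a; have [k [{}b ->]] := Rank_surj b.
rewrite inE; apply/assembly_setP/eqP => [[h]|].
  have e := in_fiber_id h; case: _ / e in b h *.
  by rewrite fib_id fmap1 ffunE inE => /eqP->.
move=> /(congr1 val)/eqP /=; rewrite tagnat.eq_Rank => /andP[/eqP e].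
case: _ / e in a * => /eqP/val_inj->.
exists (in_fiber_id_refl k).
by rewrite (eq_axiomK (in_fiber_id _)) fmap1 ffunE inE.
Qed.

Fact assembly_mapM (S T U : wreath) (g : hom T U) (f : hom S T) :
  assembly_map (comp g f) = comp (assembly_map g) (assembly_map f).
Proof.
apply: gamma_homP => a; rewrite !ffunE; apply/setP => b.
have [i [{}a ->]] := Rank_surj a; have [k [{}b ->]] := Rank_surj b.
apply/assembly_setP/bigcupP => [[h]|[c]].
  have [j /andP[hf hg]] := in_fiber_factor h.
  rewrite (fib_comp h hf hg) fmapM ffunE => /bigcupP[c ca bc].
  exists (tagnat.Rank j c); first by apply/assembly_setP; exists hf.
  by rewrite ffunE; apply/assembly_setP; exists hg.
have [j [{}c ->]] := Rank_surj c; rewrite ffunE.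
move=> /assembly_setP[hf ca] /assembly_setP[hg bc].
have h : in_fiber (base (wreath_comp g f)) i k by exact: in_fiber_comp hf hg.
by exists h; rewrite (fib_comp h hf hg) fmapM ffunE; apply/bigcupP; exists c.
Qed.

Definition assembly : functor wreath Gamma :=
  @Functor wreath Gamma assembly_ob assembly_map assembly_map1 assembly_mapM.

End Assembly.
End Wreath.

Fact unit_all_eq (x y : unit) : x = y. Proof. by case: x y => -[]. Qed.

Definition terminal : category :=
  @Category unit (fun _ _ => unit) (fun _ => tt) (fun _ _ _ _ _ => tt)
    (fun _ _ _ => unit_all_eq _ _) (fun _ _ _ => unit_all_eq _ _)
    (fun _ _ _ _ _ _ _ => unit_all_eq _ _).

Fixpoint Theta (n : nat) : category :=
  if n is n'.+1 then wreath (Theta n') else terminal.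

Definition gamma0 : functor terminal Gamma :=
  @Functor terminal Gamma (fun _ => 1%N) (fun _ _ _ => idm (1%N : Gamma))
    (fun _ => erefl) (fun _ _ _ _ _ => esym (comp1m (idm (1%N : Gamma)))).

Fixpoint gamma (n : nat) : functor (Theta n) Gamma :=
  if n is n'.+1 then assembly (gamma n') else gamma0.

Definition K (pi : zmodType) (n : nat) : presheaf (Theta n) :=
  pullback (gamma n) (H pi).

Fixpoint edges (n : nat) : Theta n -> nat :=
  if n is n'.+1 then fun T : seq (Theta n') => \sum_(T' <- T) (edges T').+1
  else fun=> 0.

Section Cells.
Variables (n : nat) (X : presheaf (Theta n)).

Definition retraction (C : category) (T S : C) (r : hom T S) : Prop :=
  exists s : hom S T, comp r s = idm S.

(* Morphisms out of T are compared together with their codomain, as elements of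
   {S & hom T S}. *)
Definition nondegenerate (T : Theta n) (x : X T) : Prop :=
  forall (S : Theta n) (r : hom T S), retraction r ->
    Tagged (hom T) r <> Tagged (hom T) (idm T) ->
    ~ exists y : X S, restr X r y = x.

(* The cells of the realisation of X: its non-degenerate elements, the
   dimension of x in X(T) being the number of edges of T. *)
Definition cells (d : nat) : set {T : Theta n & X T} :=
  [set c | nondegenerate (tagged c) /\ edges (tag c) = d]%classic.

Local Open Scope ring_scope.

(* P / Q is a rational function, defined at 0 and -1, whose power series
   expansion at 0 is the generating function sum_d c_d t^d of the numbers of
   cells (which are required to be finite). *)
Definition is_virtual_euler_char (chi : rat) : Prop :=
  exists (c : nat -> nat) (P Q : {poly rat}),
    [/\ forall d, (cells d #= `I_(c d))%card,
        Q`_0 != 0,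
        forall d, \sum_(i < d.+1) Q`_i * (c (d - i)%N)%:R = P`_d,
        Q.[-1] != 0
      & chi = P.[-1] / Q.[-1]].

Lemma virtual_euler_char_unique chi chi' :
  is_virtual_euler_char chi -> is_virtual_euler_char chi' -> chi = chi'.
Proof.
move=> [c [P [Q [hc _ hP Q1 ->]]]] [c' [P' [Q' [hc' _ hP' Q1' ->]]]].
have cc' d : c' d = c d.
  by apply/card_eq_II; apply: card_eq_trans (hc d); rewrite card_eq_sym.
suff PQ : P * Q' = P' * Q.
  by apply/eqP; rewrite eqr_div // -!hornerM PQ.
apply/polyP => N; pose C := \poly_(i < N.+1) ((c i)%:R : rat).
have expand (p q : {poly rat}) k : (k <= N)%N ->
    (forall d, \sum_(i < d.+1) q`_i * (c (d - i)%N)%:R = p`_d) ->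
    p`_k = (q * C)`_k.
  move=> kN <-; rewrite coefM; apply: eq_bigr => i _.
  by rewrite coef_poly ltnS (leq_trans (leq_subr _ _) kN).
have hP'' d : \sum_(i < d.+1) Q'`_i * (c (d - i)%N)%:R = P'`_d.
  by rewrite -hP'; apply: eq_bigr => i _; rewrite cc'.
have -> : (P * Q')`_N = (Q * C * Q')`_N.
  by rewrite !coefM; apply: eq_bigr => i _; rewrite -(expand P Q) // -ltnS.
have -> : (P' * Q)`_N = (Q' * C * Q)`_N.
  by rewrite !coefM; apply: eq_bigr => i _; rewrite -(expand P' Q') // -ltnS.
by rewrite -mulrA mulrC [C * Q']mulrC.
Qed.

End Cells.

(* Main.v *)
From mathcomp Require Import all_boot all_order all_algebra.
From mathcomp Require Import boolp classical_sets functions cardinality.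
From mathcomp Require Import ring.
Require Import Defs.

Set Implicit Arguments.
Unset Strict Implicit.
Unset Printing Implicit Defensive.

Import GRing.Theory Num.Theory.

(** The idea is that a pair of a level-tree T of height at most n + 1 and an
    element x of K(T) is the same thing as a list of such pairs one level down:
    the subtrees of T above the root, each with the labels that x puts on its
    leaves of height n + 1. Unfolding, a pair is a labelled tree: an element of
    pi at level 0, a list of labelled trees of the previous level otherwise
    ([code], bijective by [code_inj] and [code_surj]).

    In these terms the non-degenerate elements are the reduced trees, in which
    no proper subtree is zero, zero meaning the element 0 of pi at level 0 and
    the empty list at every other level ([nondegenerate_reduced]).
    - Each element is restricted from a reduced one along a retraction
      ([collapse_reduced]): reduce the subtrees one level down, then contract
      the root edges whose subtree has become zero.
    - Conversely a retraction r from which a reduced element is restricted is an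
      identity ([reduced_rigid]). Over a root edge contracted by r all labels
      vanish, so the map of ordinals underlying r contracts no edge; being
      surjective, it is an identity, and the components of r are identities
      by induction.

    Let C_n be the generating function of the numbers of cells. A reduced tree
    of level n + 1 is a list of nonzero reduced trees of level n, each entry
    bringing one more edge; zero, which has no edges, is the only reduced tree of
    level n that cannot occur as an entry. Hence
      C_(n+1) = 1 / (1 - t (C_n - 1)),   C_0 = p.
    At t = -1 this reads C_(n+1)(-1) = 1 / C_n(-1), whence p^((-1)^n). To make
    sense of the evaluation, C_n is expressed as a fraction P_n / Q_n with
    P_(n+1) = Q_n and Q_(n+1) = Q_n + t (Q_n - P_n) ([expansion_cells]); the
    values at -1 of numerator and denominator are exchanged at each step
    ([numer_denomN1]). *)

(** * Elements over a wreath product and their components *)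

Lemma Tagged_inj (I : Type) (T_ : I -> Type) (i : I) (u v : T_ i) :
  Tagged T_ u = Tagged T_ v -> u = v.
Proof.
pose c w (p : tag w = i) : T_ i := eq_rect _ T_ (tagged w) _ p.
have cE w (p : tag w = i) : Tagged T_ u = w -> c w p = u.
  by move=> e; case: _ / e in p *; rewrite (Prop_irrelevance p erefl).
by move=> e; rewrite -(cE (Tagged T_ v) erefl e).
Qed.

Section Components.
Variables (A : category) (F : functor A Gamma) (pi : zmodType).
Local Notation X := (pullback F (H pi)).
Local Notation WX := (pullback (assembly F) (H pi)).
Local Notation "T `_[ i ]" := (tnth (in_tuple T) i) (at level 3).

Definition component (T : seq A) (x : WX T) (i : 'I_(size T)) : X (T`_[i]) :=
  [ffun a => x (tagnat.Rank i a)].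

Lemma component_inj (T : seq A) (x y : WX T) :
  (forall i, component x i = component y i) -> x = y.
Proof.
move=> e; apply/ffunP => s; have [i [a ->]] := Rank_surj s.
by have /ffunP/(_ a) := e i; rewrite !ffunE.
Qed.

Lemma component_surj (T : seq A) (v : forall i, X (T`_[i])) :
  exists x : WX T, forall i, component x i = v i.
Proof.
exists [ffun s => v (tagnat.sig1 s) (tagnat.sig2 s)] => i.
apply/ffunP => a; rewrite !ffunE /tagnat.sig1 /tagnat.sig2.
by rewrite tagnat.rankK.
Qed.

(** Over a contracted edge every label is an empty sum. *)
Lemma component_restr0 (S T : seq A) (f : wreath_hom S T) (y : WX T) i :
  (forall k, ~~ in_fiber (base f) i k) ->
  component (restr WX (f : @hom (wreath A) S T) y) i = [ffun=> 0%R].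
Proof.
move=> nf; apply/ffunP => a; rewrite !ffunE big_pred0 // => b.
have [k [{}b ->]] := Rank_surj b.
by apply/negP => /assembly_setP[h]; move: (nf k); rewrite h.
Qed.

(** When a single edge k lies over i, the blocks of labels are not mixed. *)
Lemma component_restr1 (S T : seq A) (f : wreath_hom S T) (y : WX T) i k
    (h : in_fiber (base f) i k) :
  (forall k', in_fiber (base f) i k' -> k' = k) ->
  component (restr WX (f : @hom (wreath A) S T) y) i =
    restr X (fib h) (component y k).
Proof.
move=> uk; apply/ffunP => a; rewrite !ffunE.
under [RHS]eq_bigr do rewrite ffunE.
rewrite -[RHS](big_imset (fun s => y s)) /=; last first.
  by move=> ? ? _ _; apply: Rank_tag_inj.
apply: eq_bigl => b; have [k' [{}b ->]] := Rank_surj b.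
apply/assembly_setP/imsetP => [[h' ba]|[c ca]].
  have e := uk _ h'; case: _ / (esym e) in b h' ba *.
  by exists b => //; rewrite (fib_irr h h').
move=> /(congr1 val)/eqP /=; rewrite tagnat.eq_Rank => /andP[/eqP e].
by case: _ / (esym e) in b * => /eqP/val_inj->; exists h.
Qed.

End Components.

(** * Retractions of a wreath product *)

(** The section sends k to the first vertex whose image reaches k; minimality
    makes it monotone. *)
Lemma delta_section m l (phi : delta_hom m l) :
  (forall k, exists j, phi j = k) ->
  exists psi : delta_hom l m, delta_comp phi psi = delta_id l.
Proof.
move=> phi_surj.
have phi_geP (k : 'I_l.+1) : exists j : 'I_m.+1, k <= phi j.
  by have [j <-] := phi_surj k; exists j.
pose P (k : 'I_l.+1) := [pred j : 'I_m.+1 | k <= phi j].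
have exP k : {j0 | P k j0} by exact: (cid (phi_geP k)).
pose psi k : 'I_m.+1 := [arg min_(j < sval (exP k) | P k j) val j].
have psiP (k : 'I_l.+1) :
    k <= phi (psi k) /\ forall j : 'I_m.+1, k <= phi j -> psi k <= j.
  rewrite /psi; case: arg_minnP => [|j Pj min_j]; last by split.
  exact: (svalP (exP k)).
have psi_mono (i j : 'I_l.+1) :
    i <= j -> [ffun k => psi k] i <= [ffun k => psi k] j.
  rewrite !ffunE => ij; have [_ ->] // := psiP i.
  by apply: leq_trans ij _; have [] := psiP j.
exists (DeltaHom psi_mono); apply: delta_homP => k; rewrite !ffunE.
have [k_le k_min] := psiP k; have [j phij] := phi_surj k.
apply/val_inj/eqP; rewrite eqn_leq k_le andbT -[in leqRHS]phij.
by apply/dfun_mono/k_min; rewrite phij.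
Qed.

(** A longer jump would leave out the vertex after the image of i. Hence over each
    edge of the source there is at most one edge of the target, and restriction
    along a retraction involves no sums. *)
Lemma surj_delta_step m l (phi : delta_hom m l) (i : 'I_m) :
  (forall k, exists j, phi j = k) ->
  phi (lift ord0 i) <= (phi (widen_ord (leqnSn m) i)).+1.
Proof.
move=> phi_surj; rewrite leqNgt; apply/negP => jump.
have [j] := phi_surj (Ordinal (ltn_trans jump (ltn_ord _))).
move=> /(congr1 val) /= phij.
have [ji|ij] := leqP j i.
  have /(dfun_mono phi) : j <= widen_ord (leqnSn m) i by [].
  by rewrite phij ltnn.
have /(dfun_mono phi) : lift ord0 i <= j by rewrite /= /bump.
by rewrite phij leqNgt jump.
Qed.

Lemma retraction_base_surj (A : category) (S T : seq A) (r : wreath_hom T S) :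
  @retraction (wreath A) T S r -> forall k, exists j, base r j = k.
Proof.
move=> [s /(congr1 (@base _ _ _)) /= e] k.
exists (base s k).
by have := congr1 (fun phi : delta_hom _ _ => phi k) e; rewrite !ffunE.
Qed.

Section Retractions.
Variables (A : category) (F : functor A Gamma) (pi : zmodType).
Local Notation X := (pullback F (H pi)).
Local Notation WX := (pullback (assembly F) (H pi)).
Local Notation "T `_[ i ]" := (tnth (in_tuple T) i) (at level 3).

(** Degeneracy with identities allowed, so that the relation is reflexive. *)
Definition collapses (C : category) (Y : presheaf C) (T S : C) (x : Y T)
  (y : Y S) : Prop := exists2 r : hom T S, retraction r & restr Y r y = x.

(** Retractions assemble from a surjection of ordinals and componentwise
    retractions. A section of the surjection may run over edges that the
    surjection contracts; there the components of the section are arbitrary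
    morphisms, which is why all hom-sets are required to be inhabited. These
    components do not affect the composite with the retraction. *)
Lemma collapses_wreath (T S : seq A) (x : WX T) (y : WX S)
    (phi : delta_hom (size T) (size S)) :
  (forall a b : A, exists f : hom a b, True) ->
  (forall k, exists j, phi j = k) ->
  (forall i k, in_fiber phi i k -> collapses (component x i) (component y k)) ->
  (forall i, (forall k, ~~ in_fiber phi i k) -> component x i = [ffun=> 0%R]) ->
  collapses (x : WX (T : wreath A)) (y : WX (S : wreath A)).
Proof.
move=> homA phi_surj xy x0; have [psi psiK] := delta_section phi_surj.
have rsP i k : in_fiber phi i k -> {rs : hom T`_[i] S`_[k] * hom S`_[k] T`_[i] |
    comp rs.1 rs.2 = idm _ /\ restr X rs.1 (component y k) = component x i}.
  by move=> /xy h; apply: cid; case: h => r [s rs] e; exists (r, s).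
pose homE a b := sval (cid (homA a b)).
pose r : hom (T : wreath A) S :=
  @WreathHom A T S phi (fun i k h => (sval (rsP i k h)).1).
pose s : hom (S : wreath A) T := @WreathHom A S T psi (fun k i _ =>
  if @idP (in_fiber phi i k) is ReflectT h then (sval (rsP i k h)).2
  else homE _ _).
exists r.
  exists s; apply: wreath_homP => [k|k k' h h'].
    exact: (congr1 (fun f : delta_hom _ _ => f k) psiK).
  have [i /andP[hs hr]] := in_fiber_factor h.
  have e := in_fiber_id h'; case: _ / e in h h' hr *.
  rewrite (fib_comp h hs hr) fib_id /=.
  case: {-}_ / idP => // hr'; rewrite (bool_irrelevance hr' hr).
  by have [-> _] := svalP (rsP i k hr).
apply: component_inj => i.
have [[k h]|nh] := pselect (exists k, in_fiber phi i k); last first.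
  rewrite (component_restr0 (f := r)); last first.
    by move=> k; apply/negP => h; apply: nh; exists k.
  by rewrite x0 // => k; apply/negP => h; apply: nh; exists k.
rewrite (@component_restr1 _ _ _ _ _ r y i k h); last first.
  move=> k' /andP[k1' k2']; case/andP: (h) => k1 k2; apply/val_inj/eqP.
  have st := surj_delta_step i phi_surj.
  move: (leq_trans k2 st) (leq_trans k2' st); rewrite eqn_leq !ltnS => a b.
  by rewrite (leq_trans a) ?(leq_trans b).
by have [_] := svalP (rsP i k h).
Qed.

End Retractions.

(** * Elements as lists of elements one level down *)

Section ComponentSequence.
Variables (A : category) (F : functor A Gamma) (pi : zmodType).
Local Notation X := (pullback F (H pi)).
Local Notation WX := (pullback (assembly F) (H pi)).
Local Notation "T `_[ i ]" := (tnth (in_tuple T) i) (at level 3).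

Definition components (T : seq A) (x : WX T) : seq {a : A & X a} :=
  [seq Tagged X (component x i) | i <- enum 'I_(size T)].

Lemma tag_components (T : seq A) (x : WX T) : map tag (components x) = T.
Proof. by rewrite -map_comp -[RHS](map_tnth_enum (in_tuple T)). Qed.

Lemma size_components (T : seq A) (x : WX T) : size (components x) = size T.
Proof. by rewrite size_map size_enum_ord. Qed.

Lemma nth_components (T : seq A) (x : WX T) z0 (i : 'I_(size T)) :
  nth z0 (components x) i = Tagged X (component x i).
Proof.
by rewrite (nth_map i) ?size_enum_ord // nth_ord_enum.
Qed.

Lemma components_inj (S T : seq A) (y : WX S) (x : WX T) :
  components y = components x ->
  Tagged WX (y : WX (S : wreath A)) = Tagged WX (x : WX (T : wreath A)).
Proof.
move=> e; have ST : S = T.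
  by rewrite -(tag_components y) e tag_components.
case: _ / (esym ST) in y e *; congr Tagged; apply: component_inj => i.
have z0 := Tagged X (component x i).
by apply: Tagged_inj; rewrite -!(nth_components _ z0) e.
Qed.

Lemma components_surj (Z : seq {a : A & X a}) :
  exists (T : seq A) (x : WX T), components x = Z.
Proof.
pose T := map tag Z; exists T.
have eT : size T = size Z by rewrite size_map.
have vP (i : 'I_(size T)) :
    {v : X (T`_[i]) | Tagged X v = tnth (in_tuple Z) (cast_ord eT i)}.
  set z := tnth (in_tuple Z) _; have e : tag z = T`_[i].
    rewrite (tnth_nth (tag z)) [RHS]/= (nth_map z) -?eT //.
    by have -> : nth z Z i = z by rewrite [RHS](tnth_nth z).
  by case: _ / e; exists (tagged z); case: (z).
have [x xv] := component_surj (F := F) (fun i => sval (vP i)); exists x.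
rewrite /components; under eq_map => i do rewrite xv (svalP (vP i)).
move: (size T) eT {vP x xv} => m e; subst m.
under eq_map => i do rewrite cast_ord_id.
exact: (map_tnth_enum (in_tuple Z)).
Qed.

End ComponentSequence.

(** * Labelled trees *)

Section LabelledTrees.
Variable pi : finZmodType.

Fixpoint ltree n : eqType := if n is n'.+1 then seq (ltree n') else pi.

Definition ltree0 n : ltree n := if n is n'.+1 then [::] else 0%R.

Fixpoint weight n : ltree n -> nat :=
  if n is n'.+1 then fun l : seq (ltree n') => sumn [seq (weight t).+1 | t <- l]
  else fun=> 0.

(** The test bears on the subtrees only: zero itself is reduced. *)
Fixpoint reduced n : ltree n -> bool :=
  if n is n'.+1 then fun l : seq (ltree n') =>
    all (fun t => (t != ltree0 n') && reduced t) l
  else fun=> true.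

Local Notation Y n := {T : Theta n & K pi n T}.

Fixpoint code n : Y n -> ltree n :=
  if n is n'.+1 then fun z : Y n'.+1 =>
    map (@code n') (components (tagged z : pullback (assembly (gamma n')) (H pi) _))
  else fun z : Y 0 => (tagged z : {ffun 'I_1 -> pi}) ord0.

Lemma code_inj n : injective (@code n).
Proof.
elim: n => [|n IHn].
  move=> [[] x] [[] y] /= e; congr Tagged.
  by apply/ffunP => i; rewrite (ord1 i).
by move=> [S y] [T x] /= /(inj_map IHn); apply: components_inj.
Qed.

Lemma code_surj n (t : ltree n) : exists z : Y n, code z = t.
Proof.
elim: n t => [t|n IHn l].
  by exists (@Tagged unit tt (K pi 0) [ffun=> t]); rewrite /= ffunE.
have [Z ZE] : exists Z, map (@code n) Z = l.
  elim: l => [|t l [Z <-]]; first by exists [::].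
  by have [z <-] := IHn t; exists (z :: Z).
have [T [x xZ]] := components_surj Z.
by exists (Tagged (K pi n.+1) (x : K pi n.+1 T)); rewrite /= xZ.
Qed.

Lemma edges_code n (z : Y n) : edges (tag z) = weight (code z).
Proof.
elim: n z => [//|n IHn] [T x] /=.
rewrite -[in LHS](tag_components (F := gamma n) x) big_map -map_comp.
by rewrite sumnE big_map; apply: eq_bigr => z _; rewrite IHn.
Qed.

(** A reduced nonempty list has a nonzero head, hence a nonzero label; so the two
    ways of being zero, as a tree and as a family of labels, agree on reduced
    trees. *)
Lemma reduced_code0 n (z : Y n) : reduced (code z) ->
  (code z == ltree0 n) = ((tagged z : {ffun _ -> pi}) == [ffun=> 0%R]).
Proof.
elim: n z => [|n IHn] [T x] red_x.
  apply/eqP/eqP => /= [x0|->]; last by rewrite ffunE.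
  by apply/ffunP => i; rewrite (ord1 i) ffunE.
apply/eqP/eqP => /= [x0|x0].
  apply: (component_inj (F := gamma n)) => i; exfalso.
  have := size_components (F := gamma n) x.
  by rewrite -(size_map (@code n)) x0 /= => s0; case: i; rewrite -s0.
move: red_x => /=; case E: (components _) => [//|z Z] /=.
move=> /andP[/andP[/negP nz red_z] _]; case: nz; rewrite IHn //.
have T_gt0 : 0 < size T by rewrite -(size_components (F := gamma n) x) E.
have := nth_components (F := gamma n) x z (Ordinal T_gt0).
rewrite E /= => ->; apply/eqP/ffunP => a; rewrite !ffunE /=.
by move: x0 => /= ->; rewrite ffunE.
Qed.

(** * Non-degenerate elements are the reduced trees *)

(** Above level 0, a map that is constant on vertices has no components to
    supply. *)
Lemma hom_Theta n (S T : Theta n) : exists f : hom S T, True.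
Proof.
case: n => [|n] in S T *; first by exists tt.
have mono (i j : 'I_(size S).+1) : i <= j ->
    [ffun=> ord0 : 'I_(size T).+1] i <= [ffun=> ord0 : 'I_(size T).+1] j.
  by rewrite !ffunE.
have nofib i k : in_fiber (DeltaHom mono) i k -> False.
  by rewrite /in_fiber !ffunE.
by exists (@WreathHom (Theta n) S T (DeltaHom mono)
  (fun i k h => False_rect _ (nofib i k h))).
Qed.

Lemma restr0 n (S T : Theta n) (f : hom S T) :
  restr (K pi n) f [ffun=> 0%R] = [ffun=> 0%R].
Proof. by apply/ffunP => a; rewrite !ffunE big1 // => b; rewrite ffunE. Qed.

(** Stated for families of labels, which is the form of nonvanishing that conflicts
    with [component_restr0]. *)
Lemma reduced_component n (T : Theta n.+1) (x : K pi n.+1 T) i :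
  reduced (code (Tagged (K pi n.+1) x)) ->
  let xi := component (F := gamma n) x i in
  xi <> [ffun=> 0%R] /\ reduced (code (Tagged (K pi n) xi)).
Proof.
move=> /= /allP red_x.
have /red_x/andP[nz red_xi] :
    code (Tagged (K pi n) (component (F := gamma n) x i))
      \in [seq code z | z <- components (F := gamma n) x].
  by rewrite -map_comp; apply/mapP; exists i => //; exact: mem_enum.
by split=> // /eqP x0; move: nz; rewrite reduced_code0 //= => /negP.
Qed.

Lemma eq_from_tnth_seq (U : Type) (s t : seq U) : size s = size t ->
  (forall (i : 'I_(size s)) (j : 'I_(size t)), i = j :> nat ->
     tnth (in_tuple s) i = tnth (in_tuple t) j) ->
  s = t.
Proof.
case: s => [|u s] size_st st; first by case: t size_st {st}.
apply: (eq_from_nth (x0 := u) size_st) => i i_s.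
have i_t : i < size t by rewrite -size_st.
have := st (Ordinal i_s) (Ordinal i_t) erefl.
by rewrite !(tnth_nth u).
Qed.

(** Applied to a retraction that contracts no edge and to its section, this forces
    both to be identities. *)
Lemma delta_expanding m l (phi : delta_hom m l) :
  (forall i : 'I_m, phi (widen_ord (leqnSn m) i) < phi (lift ord0 i)) ->
  forall j : 'I_m.+1, j <= phi j.
Proof.
move=> phi_lt [j jm] /=; elim: j jm => // j IHj jm.
have -> : Ordinal jm = lift ord0 (Ordinal (jm : j < m)) by apply: val_inj.
apply: leq_ltn_trans (phi_lt _).
have -> : widen_ord (leqnSn m) (Ordinal (jm : j < m)) = Ordinal (ltnW jm).
  exact: val_inj.
exact: IHj.
Qed.

(** The nonzero components of x keep the base map of r from contracting an edge;
    so r and its section are identities on vertices, and the components of r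
    are again retractions, from which reduced elements are restricted. *)
Lemma reduced_rigid n (T S : Theta n) (x : K pi n T) (y : K pi n S)
    (r : hom T S) :
  reduced (code (Tagged (K pi n) x)) -> retraction r ->
  restr (K pi n) r y = x -> Tagged (hom T) r = Tagged (hom T) (idm T).
Proof.
elim: n T S x y r => [|n IHn] T S x y r.
  by case: S T r x y => -[] [] [] x y _ _ _.
move=> red_x r_retr ry.
have [s rs] := r_retr.
have rsE k : base r (base s k) = k.
  have := congr1 (fun f : wreath_hom S S => base f k) rs.
  by rewrite /= !ffunE.
(* An edge contracted by r would make a component of x zero. *)
have phi_ge : forall j : 'I_(size T).+1, j <= base r j.
  apply: delta_expanding => i; rewrite ltnNge; apply/negP => ge.
  have [+ _] := reduced_component i red_x; apply; rewrite -ry.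
  apply: (component_restr0 (F := gamma n)) => k; apply/negP => /andP[k1 k2].
  by have := leq_trans k2 (leq_trans ge k1); rewrite ltnn.
have psi_ge : forall k : 'I_(size S).+1, k <= base s k.
  apply: delta_expanding => k; rewrite ltnNge; apply/negP.
  by move/(dfun_mono (base r)); rewrite !rsE /= /bump /= add1n ltnn.
have psiE (k : 'I_(size S).+1) : base s k = k :> nat.
  by apply/eqP; rewrite eqn_leq psi_ge -{2}(rsE k) phi_ge.
have size_ST : size S = size T.
  apply/eqP; rewrite eqn_leq; apply/andP; split.
    by have := psi_ge ord_max; rewrite /= => /leq_trans -> //; rewrite -ltnS.
  by have := phi_ge ord_max; rewrite /= => /leq_trans -> //; rewrite -ltnS.
have phiE (j : 'I_(size T).+1) : base r j = j :> nat.
  have jS : j < (size S).+1 by rewrite size_ST.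
  have -> : j = base s (Ordinal jS) by apply: val_inj; rewrite /= psiE.
  by rewrite rsE psiE.
have fib_rE i k (h : in_fiber (base r) i k) :
    Tagged (hom _) (fib h) = Tagged (hom _) (idm (tnth (in_tuple T) i)).
  have kE : k = i :> nat.
    move: (h); rewrite /in_fiber !phiE /= /bump /= add1n ltnS.
    by rewrite -eqn_leq => /eqP.
  have [_ red_xi] := reduced_component i red_x.
  have hs : in_fiber (base s) k i.
    by rewrite /in_fiber !psiE /= /bump /= add1n ltnS kE leqnn.
  apply: IHn red_xi _ _; last first.
    rewrite -ry; apply/esym/(component_restr1 (F := gamma n)) => k'.
    rewrite /in_fiber !phiE /= /bump /= add1n ltnS -eqn_leq => /eqP ik'.
    by apply: val_inj; rewrite /= kE.
  exists (fib hs).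
  have hrs := in_fiber_comp hs h.
  rewrite -(fib_comp (g := r) (f := s) hrs hs h).
  have fib1 (f : wreath_hom S S) : f = wreath_id S ->
    forall h' : in_fiber (base f) k k, fib h' = idm _.
    by move=> ->; exact: fib_id.
  exact: fib1 rs hrs.
have ST : S = T.
  apply: eq_from_tnth_seq => // k i ki.
  suff h : in_fiber (base r) i k by have [] := congr1 tag (fib_rE i k h).
  by rewrite /in_fiber !phiE /= /bump /= add1n ki leqnn ltnSn.
subst S; congr Tagged; apply: wreath_homP => [i|i k hf hg].
  by apply: val_inj; rewrite /= phiE ffunE.
have e := in_fiber_id hg; subst k.
by rewrite fib_id; apply: Tagged_inj; apply: fib_rE.
Qed.

Lemma nth_filter_count (U : Type) (a : pred U) x0 s i :
  i < size s -> a (nth x0 s i) ->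
  nth x0 (filter a s) (count a (take i s)) = nth x0 s i.
Proof.
move=> i_lt ai; rewrite -[in LHS](cat_take_drop i s) filter_cat nth_cat.
rewrite take_cat size_takel ?(ltnW i_lt) // ltnn subnn take0 cats0.
by rewrite size_filter ltnn subnn (drop_nth x0) //= ai.
Qed.

Lemma count_take_surj (U : Type) (a : pred U) s k :
  k <= count a s -> exists2 j, j <= size s & count a (take j s) = k.
Proof.
elim: s k => [|u s IHs] k /=; first by rewrite leqn0 => /eqP->; exists 0.
case: k => [|k] k_le; first by exists 0.
have [|j j_le jk] := IHs (k.+1 - a u).
  by rewrite leq_subLR.
by exists j.+1 => //=; rewrite jk subnKC //; case: (a u).
Qed.

(** The subtrees are first reduced separately; those that become zero are then
    removed from the list and the corresponding root edges contracted. *)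
Lemma collapse_reduced n (T : Theta n) (x : K pi n T) :
  exists (S : Theta n) (y : K pi n S),
    collapses x y /\ reduced (code (Tagged (K pi n) y)).
Proof.
elim: n => [|n IHn] in T x *.
  exists T, x; split=> //; exists (idm T); last exact: restr1.
  by exists (idm T); rewrite comp1m.
have wP i : {w : Y n | collapses (component (F := gamma n) x i) (tagged w) /\
    reduced (code w)}.
  apply: cid; have [S [y xy]] := IHn _ (component (F := gamma n) x i).
  by exists (Tagged (K pi n) y).
pose w i := sval (wP i); pose a (z : Y n) := code z != ltree0 n.
pose Z := [seq w i | i <- enum 'I_(size T)].
have size_Z : size Z = size T by rewrite size_map size_enum_ord.
have nth_Z z0 (i : 'I_(size T)) : nth z0 Z i = w i.
  by rewrite (nth_map i) ?size_enum_ord // nth_ord_enum.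
have [S [y yZ]] := components_surj (filter a Z).
have size_S : size S = count a Z.
  by rewrite -(size_components y) yZ size_filter.
exists S, y; split; last first.
  rewrite /= yZ all_map all_filter all_map; apply/allP => i _ /=.
  apply/implyP => az; rewrite -/(a _) az; exact: (svalP (wP i)).2.
(* The vertex j goes to the number of subtrees kept among the first j, so that
   exactly the edges with a zero subtree are contracted. *)
have phi_lt j : count a (take j Z) < (size S).+1.
  rewrite ltnS size_S -{2}(cat_take_drop j Z) count_cat; exact: leq_addr.
have phi_mono (i j : 'I_(size T).+1) : i <= j ->
    [ffun j : 'I_(size T).+1 => Ordinal (phi_lt j)] i <=
    [ffun j : 'I_(size T).+1 => Ordinal (phi_lt j)] j.
  rewrite !ffunE /= => ij.
  by rewrite -(subnKC ij) takeD count_cat leq_addr.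
have fibE (i : 'I_(size T)) k : in_fiber (DeltaHom phi_mono) i k =
    a (w i) && (k == count a (take i Z) :> nat).
  rewrite /in_fiber !ffunE /= /bump /= add1n.
  rewrite (take_nth (w i)) ?size_Z // nth_Z -cats1 count_cat /= addn0.
  case: (a (w i)); rewrite /= ?addn0 ?addn1 ?ltnS.
    by rewrite -eqn_leq eq_sym.
  by apply/negP => /andP[/leq_ltn_trans/[apply]]; rewrite ltnn.
apply: (collapses_wreath (phi := DeltaHom phi_mono)).
- exact: hom_Theta.
- move=> k; have [|j j_le jk] := @count_take_surj _ a Z k.
    by rewrite -size_S -ltnS.
  rewrite size_Z -ltnS in j_le.
  by exists (Ordinal j_le); apply: val_inj; rewrite ffunE.
- move=> i k; rewrite fibE => /andP[ai /eqP kE].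
  have [xw _] := svalP (wP i); rewrite -/(w i) in xw.
  have wE : w i = Tagged (K pi n) (component y k).
    rewrite -(nth_components y (w i)) yZ kE nth_filter_count ?size_Z //.
    by rewrite nth_Z.
  by rewrite wE in xw.
move=> i nfib; have [[r _ xi] red_w] := svalP (wP i); rewrite -xi {xi}.
have : ~~ a (w i).
  apply/negP => ai.
  have lt : count a (take i Z) < size S.
    rewrite size_S -{2}(cat_take_drop i Z) count_cat.
    by rewrite (drop_nth (w i)) ?size_Z //= nth_Z ai addnA addn1 leq_addr.
  by have := nfib (Ordinal lt); rewrite fibE ai eqxx.
by rewrite negbK reduced_code0 // => /eqP ->; apply: restr0.
Qed.

Lemma nondegenerate_reduced n (T : Theta n) (x : K pi n T) :
  nondegenerate x <-> reduced (code (Tagged (K pi n) x)).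
Proof.
split=> [nondeg_x|red_x S r r_retr r_neq [y ry]]; last first.
  exact/r_neq/(reduced_rigid red_x r_retr ry).
have [S [y [[r r_retr ry] red_y]]] := collapse_reduced x.
have [r_id|r_neq] := pselect (Tagged (hom T) r = Tagged (hom T) (idm T)).
  have ST : S = T by exact: (congr1 tag r_id).
  subst S; move: ry; rewrite (Tagged_inj r_id) restr1 => <-.
  exact: red_y.
by case: (nondeg_x S r r_retr r_neq); exists y.
Qed.

End LabelledTrees.

(** * Enumerating lists by weight *)

Section ListEnumeration.
Variables (U : eqType) (w : U -> nat) (P : pred U) (E : nat -> seq U).

Definition list_weight (l : seq U) := sumn [seq (w u).+1 | u <- l].

(** All lists of weight d over the elements enumerated by weight in E: the first
    entry, of weight j, uses up j + 1. The fuel only serves to make the recursion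
    structural; any amount at least d gives the same result. *)
Fixpoint enum_lists_rec fuel d : seq (seq U) :=
  match d, fuel with
  | d'.+1, fuel'.+1 =>
    [seq ul.1 :: ul.2 | j <- iota 0 d,
       ul <- [seq (u, l) | u <- E j, l <- enum_lists_rec fuel' (d' - j)]]
  | 0, _ => [:: [::]]
  | _, _ => [::]
  end.

Definition enum_lists d := enum_lists_rec d d.

Lemma enum_lists_recS fuel d : enum_lists_rec fuel.+1 d.+1 =
  [seq ul.1 :: ul.2 | j <- iota 0 d.+1,
     ul <- [seq (u, l) | u <- E j, l <- enum_lists_rec fuel (d - j)]].
Proof. by []. Qed.

Lemma enum_lists_rec_fuel f g d : d <= f -> d <= g ->
  enum_lists_rec f d = enum_lists_rec g d.
Proof.
elim: f g d => [|f IH] [|g] [|d] //; rewrite !ltnS => df dg.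
rewrite !enum_lists_recS; congr flatten; apply: eq_map => j.
by rewrite (IH g) // (leq_trans (leq_subr _ _)).
Qed.

Lemma enum_listsS d : enum_lists d.+1 =
  [seq ul.1 :: ul.2 | j <- iota 0 d.+1,
     ul <- [seq (u, l) | u <- E j, l <- enum_lists (d - j)]].
Proof.
rewrite /enum_lists enum_lists_recS; congr flatten; apply: eq_map => j.
by rewrite (@enum_lists_rec_fuel d (d - j)) // leq_subr.
Qed.

Lemma size_enum_listsS d : size (enum_lists d.+1) =
  \sum_(j < d.+1) size (E j) * size (enum_lists (d - j)).
Proof.
rewrite enum_listsS size_allpairs_dep sumnE big_map.
rewrite -(big_mkord xpredT (fun j => size (E j) * size (enum_lists (d - j)))).
rewrite /index_iota subn0; apply: eq_bigr => j _; exact: size_allpairs.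
Qed.

Hypothesis memE : forall d u, (u \in E d) = P u && (w u == d).

Lemma mem_enum_lists d l :
  (l \in enum_lists d) = all P l && (list_weight l == d).
Proof.
elim/ltn_ind: d l => -[|d] IH l.
  by rewrite inE; case: l => // u l; rewrite /= andbF.
rewrite enum_listsS; apply/allpairsPdep/idP => [[j [ul [jd ulE ->]]]|].
  move: jd; rewrite mem_iota add0n ltnS /= => jd.
  case/allpairsP: ulE => -[u l'] [/= + + ->].
  rewrite memE IH ?ltnS ?leq_subr // => /andP[-> /eqP uj] /andP[-> /eqP l'd].
  by rewrite /list_weight /= -/(list_weight l') uj l'd addSn subnKC.
case: l => [//|u l].
move=> /= /andP[/andP[Pu Pl]].
rewrite /list_weight /= -/(list_weight l) addSn eqSS => /eqP ulE.
have ud : w u <= d by rewrite -ulE leq_addr.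
exists (w u), (u, l); split; last by [].
  by rewrite (mem_iota 0 d.+1) add0n ltnS.
apply/allpairsP; exists (u, l); split=> //=; first by rewrite memE Pu eqxx.
by rewrite IH ?ltnS ?leq_subr // Pl -ulE addKn eqxx.
Qed.

Hypothesis uniqE : forall d, uniq (E d).

Lemma enum_lists_uniq d : uniq (enum_lists d).
Proof.
elim/ltn_ind: d => -[|d] IH //; rewrite enum_listsS.
apply: allpairs_uniq_dep => [|j _|]; first exact: iota_uniq.
  apply: allpairs_uniq => //; first by rewrite IH // ltnS leq_subr.
  by move=> [u l] [u' l'] _ _.
move=> _ _ /allpairsPdep[j [ul [_ ulE ->]]] /allpairsPdep[j' [ul' [_ ulE' ->]]].
case/allpairsP: ulE => -[u l] [/= + _ ->].
case/allpairsP: ulE' => -[u' l'] [/= + _ ->] /=.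
by rewrite !memE => /andP[_ /eqP <-] /andP[_ /eqP <-] [-> ->].
Qed.

End ListEnumeration.

(** * Counting the cells *)

Section Counting.
Variable pi : finZmodType.

Fixpoint enum_reduced n : nat -> seq (ltree pi n) :=
  if n is n'.+1 then
    enum_lists (fun d => [seq t <- enum_reduced n' d | t != ltree0 pi n'])
  else fun d => if d is 0 then enum pi else [::].

Lemma enum_reducedP n d : uniq (enum_reduced n d) /\
  forall t, (t \in enum_reduced n d) = reduced t && (weight t == d).
Proof.
elim: n d => [|n IHn] d.
  by case: d => [|d]; split=> //=; rewrite ?enum_uniq // => t; rewrite mem_enum.
have memE j u : (u \in [seq t <- enum_reduced n j | t != ltree0 pi n]) =
    (u != ltree0 pi n) && reduced u && (weight u == j).
  by rewrite mem_filter (IHn j).2 andbA.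
split=> [|l]; last exact: (mem_enum_lists memE).
by apply: (enum_lists_uniq memE) => j; rewrite filter_uniq // (IHn j).1.
Qed.

(** Zero is reduced of weight 0, so removing it changes only the count in
    weight 0. *)
Lemma size_enum_nonzero n d :
  size [seq t <- enum_reduced n d | t != ltree0 pi n] + (d == 0) =
  size (enum_reduced n d).
Proof.
rewrite -(count_predC (pred1 (ltree0 pi n)) (enum_reduced n d)) addnC size_filter.
have [u mem_u] := enum_reducedP n d; congr (_ + _).
rewrite (count_uniq_mem _ u) mem_u.
by case: n {u mem_u} => [|n] /=; rewrite eq_sym.
Qed.

Lemma card_cells n d :
  (cells (X := K pi n) d #= `I_(size (enum_reduced n d)))%card.
Proof.
have [u mem_u] := enum_reducedP n d.
have cellE z : cells (X := K pi n) d z <-> code z \in enum_reduced n d.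
  rewrite mem_u -edges_code; case: z => T x; rewrite /cells /= .
  split=> [[/nondegenerate_reduced -> ->]|/andP[red_x /eqP ->]].
    by rewrite eqxx.
  by split=> //; apply/nondegenerate_reduced.
apply/card_set_bijP; exists (fun z => index (code z) (enum_reduced n d)); split.
- by move=> z /cellE; rewrite /= index_mem.
- move=> z z'; rewrite !in_setE => /cellE zE /cellE z'E zz'.
  by apply: code_inj; rewrite -(nth_index (code z) zE) zz' nth_index.
move=> k /= kE; case: (enum_reduced n d) => [|t0 s] in u mem_u cellE kE *.
  by [].
have [z zE] := code_surj (nth t0 (t0 :: s) k).
exists z; first by apply/cellE; rewrite zE mem_nth.
by rewrite zE index_uniq.
Qed.

End Counting.

(** * The generating function as a fraction *)

Section GeneratingFunction.
Local Open Scope ring_scope.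

(** The power series with coefficients c is the expansion of P / Q, written as the
    equality of the product of Q and the series with P. *)
Definition expansion (c : nat -> nat) (P Q : {poly rat}) :=
  forall d, \sum_(i < d.+1) Q`_i * (c (d - i)%N)%:R = P`_d.

(** With C the series of c and C' that of c', the hypotheses on c' say that
    C' - t (C - 1) C' = 1. Multiplying by Q and replacing Q C by P gives
    (Q + t (Q - P)) C' = Q. The proof does this with the series truncated above
    degree N, calculating modulo the polynomials that vanish up to degree N. *)
Lemma expansion_step (b c c' : nat -> nat) P Q :
  (forall d, (b d + (d == 0) = c d)%N) -> c' 0 = 1%N ->
  (forall d, c' d.+1 = \sum_(j < d.+1) b j * c' (d - j))%N ->
  expansion c P Q -> expansion c' Q (Q + 'X * (Q - P)).
Proof.
move=> bE c'0 c'S cPQ N.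
pose vanish (p : {poly rat}) := forall d, (d <= N)%N -> p`_d = 0.
have vanishM p q : vanish p -> vanish (q * p).
  move=> p0 d dN; rewrite coefM big1 // => i _.
  by rewrite p0 ?mulr0 // (leq_trans (leq_subr _ _)).
pose trunc (f : nat -> nat) := \poly_(i < N.+1) ((f i)%:R : rat).
have truncE f (q : {poly rat}) d : (d <= N)%N ->
    (q * trunc f)`_d = \sum_(i < d.+1) q`_i * (f (d - i)%N)%:R.
  move=> dN; rewrite coefM; apply: eq_bigr => i _.
  by rewrite coef_poly ltnS (leq_trans (leq_subr _ _) dN).
have v1 : vanish (Q * trunc c - P).
  by move=> d dN; rewrite coefB truncE // cPQ subrr.
have v2 : vanish (trunc c' - 1 - 'X * ((trunc c - 1) * trunc c')).
  move=> [|d] dN; rewrite !coefB coefXM coef1 coef_poly ltnS dN /=.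
    by rewrite c'0 subr0 subrr.
  rewrite subr0 truncE ?(ltnW dN) // c'S natr_sum; apply/eqP.
  rewrite subr_eq0; apply/eqP/eq_bigr => j _.
  rewrite natrM; congr (_ * _).
  rewrite coefB coef1 coef_poly (leq_trans (ltn_ord j) (leqW dN)).
  by rewrite -bE natrD addrK.
rewrite -truncE //; apply/eqP; rewrite -subr_eq0 -coefB.
suff -> : (Q + 'X * (Q - P)) * trunc c' - Q =
    Q * (trunc c' - 1 - 'X * ((trunc c - 1) * trunc c')) +
    'X * trunc c' * (Q * trunc c - P).
  by rewrite coefD !vanishM // addr0.
by ring.
Qed.

(** The recursion of [expansion_step], started from the p reduced trees of level 0,
    all of weight 0. *)
Fixpoint numer_denom (p : nat) n : {poly rat} * {poly rat} :=
  if n is n'.+1 then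
    let PQ := numer_denom p n' in (PQ.2, PQ.2 + 'X * (PQ.2 - PQ.1))
  else (p%:R%:P, 1).

Lemma expansion_cells (pi : finZmodType) n :
  let PQ := numer_denom #|pi| n in
  expansion (fun d => size (enum_reduced pi n d)) PQ.1 PQ.2.
Proof.
elim: n => [|n IHn] /=; last first.
  apply: expansion_step (size_enum_nonzero pi n) _ _ IHn => // d.
  exact: size_enum_listsS.
move=> d; rewrite coefC big_ord_recl big1 ?addr0 => [|i _].
  by rewrite coef1 mul1r subn0; case: d => //=; rewrite cardE.
by rewrite coef1 mul0r.
Qed.

Lemma denom0 p n : (numer_denom p n).2`_0 = 1.
Proof. by elim: n => [|n IHn] /=; rewrite ?coef1 // coefD coefXM addr0. Qed.

Lemma numer_denomN1 p n :
  (numer_denom p n).1.[-1] = (if odd n then 1 else p%:R) /\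
  (numer_denom p n).2.[-1] = (if odd n then p%:R else 1).
Proof.
elim: n => [|n [IHP IHQ]] /=; first by rewrite !hornerE.
rewrite !hornerE IHP IHQ; case: (odd n); split=> //=; ring.
Qed.

End GeneratingFunction.

Local Open Scope ring_scope.

Theorem proposition4p10p4 (pi : finZmodType) (p : nat) (hp : #|pi| = p)
    (n : nat) (hn : (1 <= n)%N) :
  is_virtual_euler_char (K pi n) ((p%:R : rat) ^ ((-1) ^+ n : int)).
Proof.
have p_neq0 : p%:R != 0 :> rat.
  by rewrite pnatr_eq0 -hp -lt0n; apply/card_gt0P; exists 0.
exists (fun d => size (enum_reduced pi n d)).
exists (numer_denom p n).1, (numer_denom p n).2.
have [-> ->] := numer_denomN1 p n; split.
- exact: card_cells.
- by rewrite denom0 oner_neq0.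
- by rewrite -hp; exact: expansion_cells.
- by case: ifP; rewrite ?oner_neq0.
rewrite -signr_odd; case: (odd n); rewrite /= ?expr1z ?expr0z ?divr1 ?div1r.
  by rewrite exprN1.
by [].
Qed.
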